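(* Let $G$ be a countable discrete group acting almost freely by isometries on a discrete metric space $(X,\mathrm{dist})$, and let $x_0\in X$, $L(g)=\mathrm{dist}(x_0,g\cdot x_0)$. Suppose that for some $\delta\ge 0$ and some $G$-invariant sets $T_1,\dots,T_m\subseteq X^3$ the conditions $(H_\delta)$ and $(K_\delta a)$ are satisfied. Then $G$ has the relative centroid property with respect to $T_1,\dots,T_m$.
   Context: All polynomials are assumed to have non-negative coefficients. Almost free action: the diameters (with respect to the pseudo-distance $(a,b)\mapsto L(a^{-1}b)$ on $G$) of all point stabilizers are uniformly bounded from above. A sequence of points $x_1x_2\dots x_n$ in $X$ is a $\delta$-path if $\mathrm{dist}(x_1,x_2)+\dots+\mathrm{dist}(x_{n-1},x_n)\le\mathrm{dist}(x_1,x_n)+\delta$. $(H_\delta)$: there exists a polynomial $P_\delta$ such that for any $r\ge 0$ and $x,y\in X$ the set $\{t\in X: xty \text{ is a } \delta\text{-path},\ \mathrm{dist}(x,t)\le r\}$ has at most $P_\delta(r)$ elements. $(K_\delta a)$ for the $G$-invariant sets $T_1,\dots,T_m\subseteq X^3$: there exist $C\ge 0$ and a map $\lambda\colon X^3\to\bigcup_{i=1}^m T_i$ such that if $\lambda(x,y,z)=(\alpha,\beta,\gamma)$ then $$\max\{\mathrm{dist}(\alpha,\beta),\mathrm{dist}(\beta,\gamma),\mathrm{dist}(\gamma,\alpha)\}\le C\min\{\mathrm{dist}(x,y),\mathrm{dist}(y,z),\mathrm{dist}(z,x)\}+\delta$$ and $x\alpha\beta y$, $y\beta\gamma z$, $z\gamma\alpha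 x$ are $\delta$-paths. Relative centroid property: $G$ has the relative centroid property with respect to $T_1,\dots,T_m$ (with space of centroids $X$) if there are a map $\mathfrak{rc}\colon G^2\to\bigcup_{i=1}^m T_i$ and a polynomial $P$ such that for all $r>0$: ($rc_1$) for every $k\in G$ the number of pairs $(\alpha,\gamma)\in X^2$ such that $\mathfrak{rc}(g,k)=(\alpha,\beta,\gamma)$ for some $g\in G$ with $L(g)\le r$ and some $\beta\in X$ is at most $P(r)$; ($rc_2$) for every $g\in G$ the number of pairs $(\alpha,\beta)\in X^2$ such that $\mathfrak{rc}(g,k)=(\alpha,\beta,\gamma)$ for some $k\in G$, $\gamma\in X$ is at most $P(L(g))$; ($rc_3$) for every $h\in G$ the number of pairs in $X^2$ of the form $g^{-1}\cdot(\beta,\gamma)$, where $g\in G$, $L(g)\le r$ and $\mathfrak{rc}(g,gh)=(\alpha,\beta,\gamma)$ for some $\alpha\in X$, is at most $P(r)$; ($rc_4$) for all $g,k\in G$, if $(\alpha,\beta,\gamma)=\mathfrak{rc}(g,k)$, then $\mathrm{dist}(\alpha,\beta)\le P(L(g))$, $\mathrm{dist}(\alpha,\gamma)\le P(L(k))$, $\mathrm{dist}(\beta,\gamma)\le P(L(g^{-1}k))$. *)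

(* Defs.v *)
From HB Require Import structures.
From mathcomp Require Import all_boot all_order all_algebra.
From mathcomp Require Import all_classical all_reals all_analysis.

Set Implicit Arguments.
Unset Strict Implicit.
Unset Printing Implicit Defensive.

Import Order.TTheory GRing.Theory Num.Theory.

Local Open Scope classical_set_scope.
Local Open Scope ring_scope.

(* A is finite, with at most r elements (r real, not necessarily integral) *)
Definition card_at_most (R : realType) (T : Type) (A : set T) (r : R) : Prop :=
  exists2 n : nat, (A #= `I_n)%card & n%:R <= r.

(* discreteness in the topological sense: all points are isolated *)
Definition discrete_metric (R : realType) (X : metricType R) : Prop :=
  forall x : X, open [set x].

Definition isometric_action (R : realType) (G : groupType) (X : metricType R)
    (act : G -> X -> X) : Prop :=
  [/\ forall x, act 1%g x = x,
      forall g h x, act (g * h)%g x = act g (act h x) &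
      forall g x y, mdist (act g x) (act g y) = mdist x y].

Definition act_length (R : realType) (G : groupType) (X : metricType R)
    (act : G -> X -> X) (x0 : X) (g : G) : R :=
  mdist x0 (act g x0).

Definition stabilizer (G X : Type) (act : G -> X -> X) (x : X) : set G :=
  [set g | act g x = x].

Definition almost_free (R : realType) (G : groupType) (X : Type)
    (L : G -> R) (act : G -> X -> X) : Prop :=
  exists D : R, forall x a b,
    stabilizer act x a -> stabilizer act x b -> L (a^-1 * b)%g <= D.

Definition invariant_triples (G X : Type) (act : G -> X -> X)
    (T : set (X * X * X)) : Prop :=
  forall g a b c, T (a, b, c) -> T (act g a, act g b, act g c).

(* As for [path], the nonempty sequence x :: s is given by x and s. *)
Definition delta_path (R : realType) (X : metricType R) (delta : R)
    (x : X) (s : seq X) : Prop :=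
  \sum_(d <- pairmap mdist x s) d <= mdist x (last x s) + delta.

Definition cond_H (R : realType) (X : metricType R) (delta : R) : Prop :=
  exists2 P : {poly R}, P \is a polyOver Num.nneg &
  forall (r : R) (x y : X), 0 <= r ->
    card_at_most [set t | delta_path delta x [:: t; y] /\ mdist x t <= r] P.[r].

Definition cond_Ka (R : realType) (X : metricType R) (delta : R) (m : nat)
    (T : 'I_m -> set (X * X * X)) : Prop :=
  exists (C : R) (lam : X * X * X -> X * X * X),
  [/\ 0 <= C,
      forall p, (\bigcup_i T i) (lam p) &
      forall x y z a b c, lam (x, y, z) = (a, b, c) ->
      [/\ Num.max (mdist a b) (Num.max (mdist b c) (mdist c a)) <=
          C * Num.min (mdist x y) (Num.min (mdist y z) (mdist z x)) + delta,
          delta_path delta x [:: a; b; y],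
          delta_path delta y [:: b; c; z] &
          delta_path delta z [:: c; a; x]]].

Definition relative_centroid_property (R : realType) (G : groupType)
    (X : metricType R) (L : G -> R) (act : G -> X -> X) (m : nat)
    (T : 'I_m -> set (X * X * X)) : Prop :=
  exists (rc : G * G -> X * X * X) (P : {poly R}),
  [/\ P \is a polyOver Num.nneg,
      forall p, (\bigcup_i T i) (rc p) &
      forall r : R, 0 < r ->
      [/\ forall k, card_at_most
            [set p : X * X | exists g b,
               L g <= r /\ rc (g, k) = (p.1, b, p.2)]
            P.[r],
          forall g, card_at_most
            [set p : X * X | exists k c, rc (g, k) = (p.1, p.2, c)]
            P.[L g],
          forall h, card_at_most
            [set p : X * X | exists g a b c,
               [/\ L g <= r, rc (g, (g * h)%g) = (a, b, c) &
                   p = (act g^-1%g b, act g^-1%g c)]]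
            P.[r] &
          forall g k a b c, rc (g, k) = (a, b, c) ->
            [/\ mdist a b <= P.[L g],
                mdist a c <= P.[L k] &
                mdist b c <= P.[L (g^-1 * k)%g]]]].

(* Main.v *)
Require Import Defs.
From HB Require Import structures.
From mathcomp Require Import all_boot all_order all_algebra.
From mathcomp Require Import all_classical all_reals all_analysis.
From mathcomp Require Import finmap lra.

Import Order.TTheory GRing.Theory Num.Theory.

Local Open Scope classical_set_scope.
Local Open Scope ring_scope.

(** The relative centroid of [g] and [k] is the centroid
    [lam (x0, g x0, k x0)] of the orbit triangle supplied by (K_delta a).

    Each of the three counting conditions asks for a polynomial bound on a
    set of pairs of points of [X].  In every case both points of such a pair
    lie on delta-paths between two points that do not vary with the pair, and
    both are at distance at most [(C + 1) r + 2 delta] from the first of them,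
    where [r = L g] in (rc2):
    - in (rc1) the pair (alpha, gamma) lies on a path from [x0] to [k x0];
    - in (rc2) the pair (alpha, beta) lies on a path from [x0] to [g x0];
    - in (rc3) the pair [g^-1 (beta, gamma)] lies on a path from [x0] to
      [h x0], the image under [g^-1] of one from [g x0] to [g h x0].
    The reason for the last claim is that the side from [x0] to [g x0] of the
    orbit triangle has length [L g].  The first point of the pair (alpha or
    beta) lies on a delta-path along this side, so it is within [L g + delta]
    of either end of the side.  The second point lies on that path too in
    (rc2); in (rc1) and (rc3) it is close to the first one, because the
    centroid triangle has diameter at most [C * L g + delta].

    So (H_delta) leaves at most [Q.[(C + 1) r + 2 delta]] choices for each
    coordinate, where [Q] is the polynomial of (H_delta), and the square of
    this number bounds the number of pairs ([card_pairs_on_delta_paths]).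
    Condition (rc4) holds with a linear bound, since consecutive points of a
    delta-path are no further apart than its endpoints, up to delta. *)

Lemma card_at_most_sub (R : realType) (T : choiceType) (A B : set T) (r : R) :
  A `<=` B -> card_at_most B r -> card_at_most A r.
Proof.
move=> AB [n Bn nr].
have finB : finite_set B by exists n.
have finA : finite_set A := sub_finite_set AB finB.
have [k Ak] := finA.
exists k => //; apply: le_trans nr; rewrite ler_nat.
rewrite -(card_fset_set Ak) -(card_fset_set Bn) fsubset_leq_card//.
by rewrite -fset_set_sub.
Qed.

Lemma card_at_mostW (R : realType) (T : Type) (A : set T) (r s : R) :
  r <= s -> card_at_most A r -> card_at_most A s.
Proof. by move=> rs [n An nr]; exists n => //; exact: le_trans nr rs. Qed.

Lemma card_fsetM (T U : choiceType) (A : {fset T}) (B : {fset U}) :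
  #|` (A `*` B)%fset| = (#|` A| * #|` B|)%N.
Proof.
rewrite -(size_allpairs pair (enum_fset A) (enum_fset B)).
apply: perm_size; apply: uniq_perm => [||[x y]]; first exact: fset_uniq.
  by apply: allpairs_uniq => // -[x y] [x' y'].
rewrite in_fsetM; apply/andP/allpairsP => /= [[xA yB]|]; first by exists (x, y).
by move=> [[x' y'] /= [xA yB [-> ->]]].
Qed.

Lemma card_at_mostX (R : realType) (T U : choiceType) (A : set T) (B : set U)
    (r s : R) :
  card_at_most A r -> card_at_most B s -> card_at_most (A `*` B) (r * s).
Proof.
move=> [n An nr] [k Bk ks].
have finA : finite_set A by exists n.
have finB : finite_set B by exists k.
have [l ABl] := finite_setX finA finB.
exists l => //.
suff -> : l = (n * k)%N by rewrite natrM ler_pM.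
rewrite -(card_fset_set ABl) fset_setX// card_fsetM.
by rewrite (card_fset_set An) (card_fset_set Bk).
Qed.

Section DeltaPath.
Set Implicit Arguments.
Unset Strict Implicit.
Context (R : realType) (X : metricType R) (delta : R).
Implicit Types a b c x y z : X.

Lemma delta_path3 x a y :
  delta_path delta x [:: a; y] <-> mdist x a + mdist a y <= mdist x y + delta.
Proof. by rewrite /delta_path /= !big_cons big_nil addr0. Qed.

Lemma delta_path4 x a b y :
  delta_path delta x [:: a; b; y] <->
  mdist x a + (mdist a b + mdist b y) <= mdist x y + delta.
Proof. by rewrite /delta_path /= !big_cons big_nil addr0. Qed.

Lemma delta_path4_rev x a b y :
  delta_path delta x [:: a; b; y] -> delta_path delta y [:: b; a; x].
Proof.
rewrite !delta_path4 (metric_sym y b) (metric_sym b a) (metric_sym a x).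
by rewrite (metric_sym y x); lra.
Qed.

Lemma delta_path4_drop2 x a b y :
  delta_path delta x [:: a; b; y] -> delta_path delta x [:: a; y].
Proof.
by rewrite delta_path4 delta_path3; have := metric_triangle a b y; lra.
Qed.

Lemma delta_path4_drop1 x a b y :
  delta_path delta x [:: a; b; y] -> delta_path delta x [:: b; y].
Proof.
by rewrite delta_path4 delta_path3; have := metric_triangle x a b; lra.
Qed.

Lemma delta_path4_first x a b y :
  delta_path delta x [:: a; b; y] -> mdist x a <= mdist x y + delta.
Proof.
by rewrite delta_path4; have := mdist_ge0 a b; have := mdist_ge0 b y; lra.
Qed.

Lemma delta_path4_middle x a b y :
  delta_path delta x [:: a; b; y] -> mdist a b <= mdist x y + delta.
Proof.
by rewrite delta_path4; have := mdist_ge0 x a; have := mdist_ge0 b y; lra.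
Qed.

Lemma delta_path_isometry (f : X -> X) x (s : seq X) :
  (forall y z, mdist (f y) (f z) = mdist y z) ->
  delta_path delta (f x) (map f s) <-> delta_path delta x s.
Proof.
move=> fiso; rewrite /delta_path last_map fiso.
suff -> : pairmap mdist (f x) (map f s) = pairmap mdist x s by [].
by elim: s x => //= y s IHs x; rewrite fiso IHs.
Qed.

(** The common form of the counting conditions: the two coordinates are
    counted separately, so the bound is the square of the one for points. *)
Lemma card_pairs_on_delta_paths (Q : {poly R}) (S : set (X * X)) x y (s : R) :
  (forall (r : R) x y, 0 <= r ->
    card_at_most
      [set t | delta_path delta x [:: t; y] /\ mdist x t <= r] Q.[r]) ->
  0 <= s ->
  (forall a b, S (a, b) ->
    [/\ delta_path delta x [:: a; b; y],
        mdist x a <= s & mdist x b <= s]) ->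
  card_at_most S (Q.[s] ^+ 2).
Proof.
move=> HQ s_ge0 HS; rewrite expr2.
have HQs := HQ s x y s_ge0.
apply: card_at_most_sub (card_at_mostX _ _ _ _ _ _ _ HQs HQs).
move=> [a b] /HS [path_ab xa xb]; split; split => //=.
  exact: delta_path4_drop2 path_ab.
exact: delta_path4_drop1 path_ab.
Qed.

End DeltaPath.

Theorem theorem3p19 (R : realType) (G : groupType) (X : metricType R)
  (act : G -> X -> X) (x0 : X) (delta : R) (m : nat)
  (T : 'I_m -> set (X * X * X)) :
  countable [set: G] ->
  discrete_metric X ->
  isometric_action act ->
  almost_free (act_length act x0) act ->
  0 <= delta ->
  (forall i, invariant_triples act (T i)) ->
  cond_H X delta ->
  cond_Ka delta T ->
  relative_centroid_property (act_length act x0) act T.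
Proof.
move=> _ _ [act1 actM act_iso] _ delta_ge0 _ [Q Q_nneg HQ].
move=> [C [lam [C_ge0 lamT Hlam]]].
set L := act_length act x0.
have L_ge0 g : 0 <= L g by exact: mdist_ge0.
have actK g x : act g^-1%g (act g x) = x by rewrite -actM mulVg act1.
pose lin : {poly R} := (C + 1)%:P * 'X + (2 * delta)%:P.
pose P := (Q \Po lin) ^+ 2 + ('X + delta%:P).
have lin_ge0 r : 0 <= r -> 0 <= (C + 1) * r + 2 * delta.
  by move=> r_ge0; rewrite addr_ge0 ?mulr_ge0 ?addr_ge0.
have P_val r : P.[r] = Q.[(C + 1) * r + 2 * delta] ^+ 2 + (r + delta).
  by rewrite /P /lin !hornerE horner_comp !hornerE.
have P_ge_count r : 0 <= r -> Q.[(C + 1) * r + 2 * delta] ^+ 2 <= P.[r].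
  by move=> r_ge0; rewrite P_val lerDl addr_ge0.
have P_ge_dist r d : d <= r + delta -> d <= P.[r].
  by move=> dr; rewrite P_val (le_trans dr)// lerDr sqr_ge0.
have P_nneg : P \is a polyOver Num.nneg.
  (* The closure properties are attached to the predicate underlying the
     qualifier [Num.nneg]. *)
  rewrite -[has_quality 0 _]/(@Num.Def.nneg_num_pred R) in Q_nneg *.
  have nnegP (c : R) : 0 <= c -> c \in @Num.Def.nneg_num_pred R by [].
  have lin_nneg : lin \is a polyOver (@Num.Def.nneg_num_pred R).
    by rewrite /lin rpredD ?rpredM ?polyOverX ?polyOverC ?nnegP
               ?mulr_ge0 ?addr_ge0.
  by rewrite /P !rpredD ?rpredX ?polyOver_comp ?polyOverX ?polyOverC ?nnegP.
pose rc (p : G * G) := lam (x0, act p.1 x0, act p.2 x0).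
have rcP g k a b c : rc (g, k) = (a, b, c) ->
    [/\ mdist a c <= C * L g + delta, mdist b c <= C * L g + delta,
        delta_path delta x0 [:: a; b; act g x0],
        delta_path delta (act g x0) [:: b; c; act k x0] &
        delta_path delta x0 [:: a; c; act k x0]].
  move=> /Hlam [size_abc pxy pyz /delta_path4_rev pxz].
  have minL : C * Num.min (mdist x0 (act g x0)) (Num.min
      (mdist (act g x0) (act k x0)) (mdist (act k x0) x0)) + delta
      <= C * L g + delta.
    by rewrite lerD2r ler_wpM2l// ge_min lexx.
  have := le_trans size_abc minL.
  by rewrite !ge_max (metric_sym c a) => /and3P[_ bc ac].
(* A point within the diameter of the centroid triangle from a point close to
   an end of the side of length [L g] is itself close to that end; this is
   where the argument [(C + 1) r + 2 delta] of [Q] comes from. *)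
have pair_near g r (x a b : X) : L g <= r -> mdist x a <= L g + delta ->
    mdist a b <= C * L g + delta ->
    mdist x a <= (C + 1) * r + 2 * delta /\
    mdist x b <= (C + 1) * r + 2 * delta.
  move=> Lr xa ab.
  have CLr : C * L g <= C * r by rewrite ler_wpM2l.
  have Cr_ge0 : 0 <= C * r by rewrite mulr_ge0// (le_trans (L_ge0 g)).
  by have := metric_triangle x a b; split; lra.
exists rc, P; split=> // [p|r r_gt0]; first exact: lamT.
have r_ge0 := ltW r_gt0.
split=> [k|g|h|g k a b c /rcP[_ _ pxy pyz pxz]].
- apply: (card_at_mostW _ _ _ _ _ (P_ge_count _ r_ge0)).
  apply: (@card_pairs_on_delta_paths _ _ _ _ _ x0 (act k x0) _ HQ
            (lin_ge0 _ r_ge0)).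
  move=> a c [g [b [/= Lr /rcP[ac _ pxy _ pxz]]]].
  have [xa xc] := pair_near _ _ _ _ _ Lr (delta_path4_first pxy) ac.
  by split.
- apply: (card_at_mostW _ _ _ _ _ (P_ge_count _ (L_ge0 g))).
  apply: (@card_pairs_on_delta_paths _ _ _ _ _ x0 (act g x0) _ HQ
            (lin_ge0 _ (L_ge0 g))).
  move=> a b [k [c /rcP[_ _ pxy _ _]]].
  have CL_ge0 : 0 <= C * L g by rewrite mulr_ge0.
  have xa := delta_path4_first pxy.
  have := delta_path4_drop1 pxy; rewrite delta_path3 => xb.
  have bg_ge0 := mdist_ge0 b (act g x0).
  split; [exact: pxy| |]; rewrite -/(act_length act x0 g) -/L in xa xb *; lra.
- apply: (card_at_mostW _ _ _ _ _ (P_ge_count _ r_ge0)).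
  apply: (@card_pairs_on_delta_paths _ _ _ _ _ x0 (act h x0) _ HQ
            (lin_ge0 _ r_ge0)).
  move=> b' c' [g [a [b [c [Lr /rcP[_ bc pxy pyz _] [-> ->]]]]]].
  have yb : mdist (act g x0) b <= L g + delta.
    have := delta_path4_first (delta_path4_rev pxy).
    by rewrite (metric_sym _ x0).
  have [yb' yc'] := pair_near _ _ _ _ _ Lr yb bc.
  move: pyz; rewrite actM.
  rewrite -(delta_path_isometry _ _ _ (act_iso g^-1%g)) /= !actK => pxh.
  by split=> //; rewrite -(act_iso g) -actM mulgV act1.
- split; apply: P_ge_dist.
  + exact: delta_path4_middle pxy.
  + exact: delta_path4_middle pxz.
  + have := delta_path4_middle pyz.
    by rewrite -(act_iso g^-1%g (act g x0)) actK -actM.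
Qed.
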